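(* Let $V$ and $Q$ be real Hilbert spaces with norms $\Vert\cdot\Vert_V$ and $\Vert\cdot\Vert_Q$ induced by their inner products. Let $a:V\times V\to\mathbb{R}$ and $c:Q\times Q\to\mathbb{R}$ be symmetric positive semidefinite bilinear forms and let $b:V\times Q\to\mathbb{R}$ be a bilinear form. Assume that $\Vert\cdot\Vert_V$ and $\Vert\cdot\Vert_Q$ are fitted norms (with respect to $b$ and $c$, with associated seminorms $\vert\cdot\vert_Q$ on $Q$ and $\vert\cdot\vert_V$, $\vert\cdot\vert_b$ on $V$, as defined in the context). This implies that $$b(v,q)\le \Vert v\Vert_V\Vert q\Vert_Q\quad\forall v\in V,\ q\in Q,\qquad c(p,q)\le\Vert p\Vert_Q\Vert q\Vert_Q\quad\forall p,q\in Q.$$ Assume further: (1) $a$ is continuous: there is a constant $\bar C_a$ with $a(u,v)\le \bar C_a\Vert u\Vert_V\Vert v\Vert_V$ for all $u,v\in V$; (2) there is a constant $\underline{C}_a>0$ with $$a(v,v)\ge \underline{C}_a\,\vert v\vert_V^2\qquad\forall v\in V;$$ (3) there is a constant $\underline{\beta}>0$ with $$\sup_{v\in V,\ v\ne 0}\frac{b(v,q)}{\Vert v\Vert_V}\ \ge\ \underline{\beta}\,\vert q\vert_Q\qquad\forall q\in Q.$$ Let $Y:=V\times Q$ with norm $\Vert (v;q)\Vert_Y^2:=\Vert v\Vert_V^2+\Vert q\Vert_Q^2$, and define $$\mathcal{A}((u;p),(v;q)):=a(u,v)+b(v,p)+b(u,q)-c(p,q),\qquad (u;p),(v;q)\in Y.$$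 Then $\mathcal{A}$ is continuous and inf-sup stable with respect to $\Vert\cdot\Vert_Y$, i.e. there exist constants $\bar C>0$ and $\underline{\alpha}>0$ such that $$\mathcal{A}(x,y)\le \bar C\,\Vert x\Vert_Y\Vert y\Vert_Y\qquad\forall x,y\in Y$$ and $$\inf_{x\in Y,\ x\neq 0}\ \sup_{y\in Y,\ y\neq 0}\ \frac{\mathcal{A}(x,y)}{\Vert x\Vert_Y\Vert y\Vert_Y}\ \ge\ \underline{\alpha}.$$
   Context: Setting: $V'$, $Q'$ denote the dual spaces and $\langle\cdot,\cdot\rangle$ the duality pairings. The forms $b$ and $c$ are bounded with respect to $\Vert\cdot\Vert_V$, $\Vert\cdot\Vert_Q$ (so that the operators below are well defined; the fitted structure then gives the bounds with constant $1$). The operator $B:V\to Q'$ is defined by $\langle Bv,q\rangle_{Q'\times Q}=b(v,q)$ for all $v\in V$, $q\in Q$, and $\mathrm{Ker}(B)=\{v\in V: b(v,q)=0\ \forall q\in Q\}$. Fitted norms: the norms $\Vert\cdot\Vert_Q$ and $\Vert\cdot\Vert_V$ are called fitted if the following two splittings hold. (a) For all $q\in Q$, $\Vert q\Vert_Q^2=\vert q\vert_Q^2+c(q,q)$, where $\vert\cdot\vert_Q$ is a seminorm on $Q$ arising from a symmetric positive semidefinite bilinear form $d$ on $Q$, i.e. $\vert q\vert_Q^2=d(q,q)$. The operator $\bar Q:Q\to Q'$, $\langle\bar Qp,q\rangle_{Q'\times Q}:=c(p,q)+d(p,q)=(p,q)_Q$, is then the Riesz isometric isomorphism of $Q$ onto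 $Q'$. (b) For all $v\in V$, $\Vert v\Vert_V^2=\vert v\vert_V^2+\vert v\vert_b^2$, where $\vert\cdot\vert_V$ is a seminorm on $V$ (which is a norm on $\mathrm{Ker}(B)$, with $\vert v\vert_V^2$ equivalent to $a(v,v)$, up to positive constants, for $v\in\mathrm{Ker}(B)$), and $$\vert v\vert_b^2:=\langle Bv,\bar Q^{-1}Bv\rangle_{Q'\times Q}=\Vert Bv\Vert_{Q'}^2,\qquad \Vert Bv\Vert_{Q'}=\sup_{q\in Q,\ q\ne0}\frac{b(v,q)}{\Vert q\Vert_Q}.$$ Only the sums in (a) and (b) need to be full norms; the individual terms may be seminorms. Suprema of the quotients $\frac{b(v,q)}{\Vert v\Vert_V}$ (over $v\in V$, $v\ne0$), $\frac{b(v,q)}{\Vert q\Vert_Q}$ (over $q\in Q$, $q\ne0$) and $\frac{\mathcal{A}(x,y)}{\Vert x\Vert_Y\Vert y\Vert_Y}$ (over $y\in Y$, $y\ne0$) over an empty set are read as $0$. *)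

(* Defs.v *)
From HB Require Import structures.
From mathcomp Require Import all_boot all_order all_algebra sesquilinear.
From mathcomp Require Import boolp classical_sets reals ereal topology normedtype.

Set Implicit Arguments.
Unset Strict Implicit.
Unset Printing Implicit Defensive.

Import Order.TTheory GRing.Theory Num.Theory.
Import numFieldNormedType.Exports.

Local Open Scope classical_set_scope.
Local Open Scope ring_scope.

(* A real Hilbert space is a complete normed module X together with an inner
   product ip : {dot X for idfun} such that [norm_induced_by ip]. *)
Definition norm_induced_by (R : realType) (X : normedModType R)
    (ip : {dot X for idfun}) : Prop :=
  forall x : X, `|x| = Num.sqrt (ip x x).

Definition possemidef (R : realType) (X : lmodType R) (f : {symmetric X}) :
    Prop :=
  forall x : X, 0 <= f x x.

Definition form_seminorm (R : realType) (X : lmodType R) (f : {symmetric X})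
    (x : X) : R :=
  Num.sqrt (f x x).

Definition is_seminorm (R : realType) (X : lmodType R) (N : X -> R) : Prop :=
  [/\ forall x, 0 <= N x,
      forall (k : R) x, N (k *: x) = `|k| * N x
    & forall x y, N (x + y) <= N x + N y].

Definition bounded_form (R : realType) (X Z : normedModType R)
    (f : X -> Z -> R) : Prop :=
  exists M : R, forall x z, `|f x z| <= M * `|x| * `|z|.

Section FittedNorms.
Context (R : realType) (V Q : completeNormedModType R).
Variables (a : {symmetric V}) (b : {bilinear V -> Q -> R | *%R & *%R}).
Variables (c d : {symmetric Q}).
Variable NV : V -> R.

(* Continuous functionals on Q are represented by their underlying functions
   Q -> R, so that the duality pairing is application. *)
Definition opB (v : V) : Q -> R := fun q => b v q.

Definition kerB : set V := [set v | forall q, b v q = 0].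

Definition opQbar (p : Q) : Q -> R := fun q => c p q + d p q.

(* When [fittedQ] holds, opQbar is the Riesz isomorphism of Q onto its dual, so
   the p below exists and is unique for each continuous linear l; the default
   value 0 is only taken for other l. *)
Definition opQbar_inv (l : Q -> R) : Q := xget 0 [set p | opQbar p = l].

(* |v|_b *)
Definition seminorm_b (v : V) : R :=
  Num.sqrt (opB v (opQbar_inv (opB v))).

Definition fittedQ : Prop :=
  possemidef d /\
  forall q : Q, `|q| ^+ 2 = form_seminorm d q ^+ 2 + c q q.

Definition fittedV : Prop :=
  [/\ is_seminorm NV,
      forall v, kerB v -> NV v = 0 -> v = 0,
      exists k K : R, [/\ 0 < k, 0 < K
        & forall v, kerB v -> k * NV v ^+ 2 <= a v v <= K * NV v ^+ 2]
    & forall v : V, `|v| ^+ 2 = NV v ^+ 2 + seminorm_b v ^+ 2].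

(* The Hilbert-space norm on the product; the library's norm on V * Q is the
   maximum of the two norms. *)
Definition normY (x : V * Q) : R := Num.sqrt (`|x.1| ^+ 2 + `|x.2| ^+ 2).

Definition calA (x y : V * Q) : R :=
  a x.1 y.1 + b y.1 x.2 + b x.1 y.2 - c x.2 y.2.

(* The inner supremum is real (hence 0 over the empty set); the outer infimum is
   an extended real, so that it is +oo when V * Q is the zero space. *)
Definition infsup_calA : \bar R :=
  ereal_inf [set (sup [set calA x y / (normY x * normY y)
                      | y in [set y : V * Q | y != 0]])%:E
            | x in [set x : V * Q | x != 0]].

End FittedNorms.

(* Main.v *)
(* Let p_u in Q be the Riesz representative of Bu, so that |u|_b = ||p_u||_Q;
   p_u exists by completeness of Q, as the minimizer of ||p||_Q^2 - 2 <Bu, p>.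
   Continuity is then Cauchy-Schwarz.  For the inf-sup bound at x = (u; p), pick
   v with ||v||_V <= |p|_Q and b(v, p) >= (beta / 2) |p|_Q^2, and test with
   y = (k u + v; - k p + p_u).  The terms k b(u, p) cancel, p_u contributes
   |u|_b^2 and v contributes |p|_Q^2; the cross terms a(u, v) and c(p, p_u) are
   absorbed by AM-GM for k = 1 + C_a / beta, so A(x, y) >= m ||x||_Y^2 while
   ||y||_Y <= 2 (k + 1) ||x||_Y. *)
Require Import Defs.
From HB Require Import structures.
From mathcomp Require Import all_boot all_order all_algebra sesquilinear.
From mathcomp Require Import boolp classical_sets reals ereal topology normedtype.
From mathcomp Require Import sequences ring lra.

Set Implicit Arguments.
Unset Strict Implicit.
Unset Printing Implicit Defensive.

Import Order.TTheory GRing.Theory Num.Theory.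
Import numFieldNormedType.Exports.

Local Open Scope classical_set_scope.
Local Open Scope ring_scope.

(** * Semidefinite symmetric forms and Cauchy-Schwarz *)

Lemma symmetric_formC (R : realType) (X : lmodType R) (f : {symmetric X})
    (x y : X) :
  f x y = f y x.
Proof. by rewrite hermC expr0 mul1r. Qed.

Lemma symmetric_formDZ (R : realType) (X : lmodType R) (f : {symmetric X})
    (x y : X) (t : R) :
  f (x + t *: y) (x + t *: y) = f x x + 2 * t * f x y + t ^+ 2 * f y y.
Proof.
rewrite !(linearDl, linearDr) /= !(linearZl_LR, linearZr_LR) /=.
rewrite (symmetric_formC f y x); ring.
Qed.

(** The form at [x + t *: y] is a nonnegative polynomial in [t]. If [f y y] is positive, its minimum
    gives the bound; otherwise it is affine, so its slope vanishes. *)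
Lemma psd_cauchy_schwarz (R : realType) (X : lmodType R) (f : {symmetric X}) :
  possemidef f -> forall x y : X, f x y ^+ 2 <= f x x * f y y.
Proof.
move=> f_psd x y; have fx := f_psd x.
have [fy0|fy0] := eqVneq (f y y) 0.
  rewrite fy0 mulr0; have [->|fxy] := eqVneq (f x y) 0; first by rewrite expr0n.
  (* A nonzero slope would allow this [t], where the value is [-1]. *)
  have := f_psd (x + (- (f x x + 1) / (2 * f x y)) *: y).
  rewrite symmetric_formDZ fy0 mulr0 addr0.
  have -> : 2 * (- (f x x + 1) / (2 * f x y)) * f x y = - (f x x + 1) by field.
  lra.
have fy : 0 < f y y by rewrite lt_def fy0 f_psd.
have := f_psd (x + (- f x y / f y y) *: y); rewrite symmetric_formDZ.
have -> : f x x + 2 * (- f x y / f y y) * f x y + (- f x y / f y y) ^+ 2 * f y y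
  = (f x x * f y y - f x y ^+ 2) / f y y by field.
by rewrite pmulr_lge0 ?invr_gt0// subr_ge0.
Qed.

Lemma psd_cauchy_schwarz_norm (R : realType) (X : normedModType R)
    (f : {symmetric X}) (C : R) :
  possemidef f -> 0 <= C -> (forall x, f x x <= C * `|x| ^+ 2) ->
  forall x y : X, `|f x y| <= C * (`|x| * `|y|).
Proof.
move=> f_psd C0 fC x y.
rewrite -(ler_pXn2r (n := 2)) ?nnegrE ?mulr_ge0//.
rewrite real_normK ?num_real//.
apply: le_trans (psd_cauchy_schwarz f_psd x y) _.
have -> : (C * (`|x| * `|y|)) ^+ 2 = (C * `|x| ^+ 2) * (C * `|y| ^+ 2) by ring.
by apply: ler_pM; rewrite ?f_psd.
Qed.

(** * Riesz representation by the direct method *)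

(** Near-minimizers [u n] of [J] form a Cauchy sequence. Each satisfies [f (u n) q = l q] up to an
    error [|q| / n.+1], which vanishes in the limit [p]. *)
Lemma riesz_representation (R : realType) (X : completeNormedModType R)
    (f : {symmetric X}) (l : {scalar X}) (M : R) :
  (forall x, f x x = `|x| ^+ 2) -> (forall x, `|l x| <= M * `|x|) ->
  exists p, forall q, f p q = l q.
Proof.
move=> fnorm lM.
pose J x := f x x - 2 * l x; pose m := inf (range J).
have J_lb : has_lbound (range J).
  exists (- M ^+ 2) => _ [x _ <-]; rewrite /J fnorm.
  have := lM x; rewrite ler_norml => /andP[_ lx].
  have := sqr_ge0 (`|x| - M); nra.
have mJ x : m <= J x by apply: ge_inf => //; exists x.
(* The parallelogram identity at the midpoint of x and y: near-minimizers of J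
   are close to each other. *)
have J_dist x y : `|x - y| ^+ 2 <= 2 * (J x - m) + 2 * (J y - m).
  have fxy : `|x - y| ^+ 2 = f x x - 2 * f x y + f y y.
    by rewrite -fnorm -scaleN1r symmetric_formDZ; ring.
  have fyx : f (y - x) (y - x) = f x x - 2 * f x y + f y y.
    by rewrite -scaleN1r symmetric_formDZ (symmetric_formC f y x); ring.
  have := mJ (x + 2^-1 *: (y - x)).
  rewrite /J symmetric_formDZ fyx linearBr/= (linearD l) (linearZ_LR l)/=.
  rewrite (linearB l) fxy; lra.
(* The tolerance is squared because [J_dist] controls a squared distance. *)
have J_lim e : 0 < e -> exists x, J x < m + e ^+ 2.
  move=> /(exprn_gt0 2) e0.
  have [|_ [x _ <-] ?] := inf_adherent e0 (conj _ J_lb).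
    by exists (J 0), 0.
  by exists x.
have Sn0 n : 0 < n.+1%:R^-1 :> R by rewrite invr_gt0.
have [u uJ] := choice (fun n => J_lim _ (Sn0 n)).
have /cauchy_cvgP/cvg_ex[p /= up] : cauchy (u @ \oo).
  apply: cauchy_exP => e e0.
  have e20 : 0 < e / 2 by lra.
  near \oo => N.
  have Ne : N.+1%:R^-1 < e / 2.
    by near: N; exact: near_infty_natSinv_lt (PosNum e20).
  exists (u N); suff : \forall n \near \oo, ball (u N) e (u n) by [].
  near=> n; rewrite -ball_normE /ball_/=.
  have nN : n.+1%:R^-1 <= N.+1%:R^-1 :> R.
    by rewrite lef_pV2 ?posrE// ler_nat ltnS; near: n; exact: nbhs_infty_ge.
  have n0 := Sn0 n.
  have := J_dist (u N) (u n); have := uJ N; have := uJ n.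
  have := normr_ge0 (u N - u n).
  move: nN n0 (Sn0 N) Ne.
  move: (`|u N - u n|) (J (u n)) (J (u N)) (n.+1%:R^-1) (N.+1%:R^-1).
  move=> D jn jN rn rN rnN n0 N0 Ne D0 Jn JN Dj.
  (* [J_dist] gives [D ^+ 2 < 2 * rN ^+ 2 + 2 * rn ^+ 2], and [rn <= rN]. *)
  suff : D < 2 * rN by lra.
  rewrite -(ltr_pXn2r (n := 2)) ?nnegrE ?mulr_ge0 ?(ltW N0)// exprMn.
  have : rn ^+ 2 <= rN ^+ 2 by rewrite ler_pXn2r ?nnegrE ?(ltW n0) ?(ltW N0).
  lra.
exists p => q; apply/eqP; rewrite -subr_eq0 -normr_le0.
apply/ler_addgt0Pr => e e0.
(* First-order condition: moving from x along q cannot push J below m. *)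
have near_min x k : 0 < k -> J x < m + k ^+ 2 -> `|f x q - l q| <= k * `|q|.
  move=> k0 Jx; have [->|q0] := eqVneq q 0.
    by rewrite linear0r linear0 subr0 !normr0 mulr0.
  have {}q0 : 0 < `|q| by rewrite normr_gt0.
  rewrite -(ler_pXn2r (n := 2)) ?nnegrE ?mulr_ge0 ?(ltW k0)//.
  rewrite real_normK ?num_real//.
  (* This point minimizes [J] on the line through [x] along [q]. *)
  have := mJ (x + (- (f x q - l q) / `|q| ^+ 2) *: q).
  rewrite /J symmetric_formDZ (linearD l) (linearZ_LR l) /= (fnorm q).
  set t := f x q - l q; rewrite (_ : f x x + _ + _ - _ = J x - (t / `|q|) ^+ 2).
    move=> mt; have : (t / `|q|) ^+ 2 <= k ^+ 2 by lra.
    by rewrite exprMn exprVn ler_pdivrMr ?exprn_gt0// exprMn.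
  by rewrite /t /J; field; rewrite gt_eqF.
(* The errors from [p - u n] and from [near_min] are each at most [e' * |q|]; the [+ 1] covers
   [q = 0]. *)
pose e' := e / (2 * (`|q| + 1)).
have q1 : 0 < `|q| + 1 by rewrite ltr_wpDl.
have e'0 : 0 < e' by rewrite divr_gt0// mulr_gt0.
near \oo => n.
have pn : `|p - u n| < e' by near: n; move/cvgrPdist_lt : up; apply.
have ne : n.+1%:R^-1 < e' by near: n; exact: near_infty_natSinv_lt (PosNum e'0).
have := near_min _ _ (Sn0 n) (uJ n).
have : `|f (p - u n) q| <= 1 * (`|p - u n| * `|q|).
  apply: psd_cauchy_schwarz_norm => // x; first by rewrite fnorm sqr_ge0.
  by rewrite fnorm mul1r.
rewrite mul1r add0r.
have -> : f (p - u n) q = f p q - f (u n) q by rewrite linearBl.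
move=> h1 h2.
have -> : f p q - l q = (f p q - f (u n) q) + (f (u n) q - l q) by ring.
apply: le_trans (ler_normD _ _) _; apply: le_trans (lerD h1 h2) _.
rewrite -mulrDl; apply: (@le_trans _ _ (2 * e' * (`|q| + 1))).
  apply: ler_pM => //.
    by rewrite mulr_natl mulr2n; apply: lerD; apply: ltW.
  by rewrite lerDl.
by rewrite /e' le_eqVlt; apply/orP; left; apply/eqP; field; rewrite gt_eqF.
Unshelve. all: end_near.
Qed.

(** * Absorbing cross terms and extracting witnesses from suprema *)

Lemma norm_le_amgm (R : realType) (t s r : R) :
  0 <= s -> 0 <= r -> t ^+ 2 <= 4 * s * r -> `|t| <= s + r.
Proof.
move=> s0 r0 tsr; rewrite -(ler_pXn2r (n := 2)) ?nnegrE ?addr_ge0//.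
rewrite real_normK ?num_real//; have := sqr_ge0 (s - r); lra.
Qed.

(** The supremum may not be attained, so half of it is given up; a nearly optimal vector is then
    rescaled to norm [r]. *)
Lemma sup_quotient_witness (R : realType) (X : normedModType R)
    (l : {scalar X}) (k r : R) :
  0 <= k -> 0 <= r -> k <= sup [set l v / `|v| | v in [set v : X | v != 0]] ->
  exists2 v, `|v| <= r & k / 2 * r <= l v.
Proof.
move=> k0 r0; set S := [set _ | _ in _] => kS.
have [->|k_neq0] := eqVneq k 0.
  by exists 0; rewrite ?normr0// linear0 !mul0r.
have kgt0 : 0 < k by rewrite lt_def k_neq0.
(* The supremum of the empty set is [0], which [0 < k] excludes. *)
have Sn : S !=set0.
  apply/set0P; apply/eqP => S0; move: kS; rewrite S0 sup0; lra.
have [||_ [v v0 <-] lv] := @sup_gt R S (k / 2) => //; first by lra.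
have {}v0 : 0 < `|v| by rewrite normr_gt0.
exists ((r / `|v|) *: v).
  by rewrite normrZ ger0_norm ?divr_ge0// divfK// gt_eqF.
rewrite linearZ_LR /= (_ : r / `|v| * l v = l v / `|v| * r); last by ring.
by apply: ler_wpM2r => //; exact: ltW.
Qed.

Lemma sqr_norm_induced (R : realType) (X : normedModType R)
    (ip : {dot X for idfun}) :
  norm_induced_by ip -> forall x, ip x x = `|x| ^+ 2.
Proof.
move=> ipN x; rewrite ipN sqr_sqrtr//.
have [->|x0] := eqVneq x 0; first by rewrite linear0l.
exact/ltW/neq0_dnorm_gt0.
Qed.

(** * Bounds implied by fitted norms *)

Section FittedNorms.
Context (R : realType) (V Q : completeNormedModType R).
Variables (ipQ : {symmetric Q}) (ipE : forall x, ipQ x x = `|x| ^+ 2).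
Variables (a : {symmetric V}) (b : {bilinear V -> Q -> R | *%R & *%R}).
Variables (c d : {symmetric Q}) (NV : V -> R).
Hypotheses (a_psd : possemidef a) (c_psd : possemidef c).
Hypotheses (b_bounded : bounded_form b).
Hypotheses (fitQ : fittedQ c d) (fitV : fittedV a b c d NV).

Let d_psd : possemidef d. Proof. by case: fitQ. Qed.

Lemma fittedQ_sqr_norm (q : Q) : `|q| ^+ 2 = d q q + c q q.
Proof. by case: fitQ => _ ->; rewrite /form_seminorm sqr_sqrtr ?d_psd. Qed.

Lemma form_seminorm_le_norm (q : Q) : form_seminorm d q <= `|q|.
Proof.
rewrite -(ler_pXn2r (n := 2)) ?nnegrE ?sqrtr_ge0//.
by case: fitQ => _ ->; rewrite lerDl c_psd.
Qed.

Lemma c_le_sqr_norm (q : Q) : c q q <= `|q| ^+ 2.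
Proof. by rewrite fittedQ_sqr_norm lerDr d_psd. Qed.

Lemma norm_c_le (p q : Q) : `|c p q| <= `|p| * `|q|.
Proof.
rewrite -[leRHS]mul1r; apply: psd_cauchy_schwarz_norm => // x.
by rewrite mul1r c_le_sqr_norm.
Qed.

(** Polarization: both sides are symmetric with the same diagonal, so comparing them at [p + q]
    identifies the mixed terms. *)
Lemma opQbarE (p q : Q) : opQbar c d p q = ipQ p q.
Proof.
have : ipQ (p + 1 *: q) (p + 1 *: q) =
    d (p + 1 *: q) (p + 1 *: q) + c (p + 1 *: q) (p + 1 *: q).
  by rewrite ipE fittedQ_sqr_norm.
rewrite !symmetric_formDZ /opQbar !ipE !fittedQ_sqr_norm; lra.
Qed.

(** The Riesz representative of [b v] is a preimage of [opB v] under [opQbar], so [opQbar_inv] does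
    not fall back on its default. *)
Lemma opB_riesz (v : V) :
  exists2 p, forall q, b v q = opQbar c d p q & seminorm_b b c d v = `|p|.
Proof.
have [M bM] := b_bounded.
have [p pb] := @riesz_representation R Q ipQ (b v) (M * `|v|) ipE (bM v).
have Bp : [set p | opQbar c d p = opB b v] p.
  by apply/funext => q; rewrite opQbarE pb.
have := xgetI 0 Bp; rewrite -/(opQbar_inv c d (opB b v)) => Bv.
exists (opQbar_inv c d (opB b v)) => [q|]; first by rewrite Bv.
by rewrite /seminorm_b -{1}Bv opQbarE ipE sqrtr_sqr normr_id.
Qed.

Lemma seminorm_b_le_norm (v : V) : seminorm_b b c d v <= `|v|.
Proof.
rewrite -(ler_pXn2r (n := 2)) ?nnegrE ?sqrtr_ge0//.
by case: fitV => _ _ _ ->; rewrite lerDr sqr_ge0.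
Qed.

(** Cauchy-Schwarz in [Q] for the representative [p] of [b v], whose norm is [|v|_b]. *)
Lemma norm_b_le (v : V) (q : Q) : `|b v q| <= `|v| * `|q|.
Proof.
have [p pb vp] := opB_riesz v.
rewrite pb opQbarE; apply: (@le_trans _ _ (1 * (`|p| * `|q|))).
  by apply: (@psd_cauchy_schwarz_norm _ _ ipQ) => // x; rewrite ?mul1r ?ipE//.
by rewrite mul1r -vp ler_wpM2r// seminorm_b_le_norm.
Qed.

(** * Comparison of [normY] with the component norms *)

Lemma norm1_le_normY (x : V * Q) : `|x.1| <= normY x.
Proof.
rewrite -[leLHS]normr_id -sqrtr_sqr ler_sqrt ?addr_ge0 ?sqr_ge0//.
by rewrite lerDl sqr_ge0.
Qed.

Lemma norm2_le_normY (x : V * Q) : `|x.2| <= normY x.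
Proof.
rewrite -[leLHS]normr_id -sqrtr_sqr ler_sqrt ?addr_ge0 ?sqr_ge0//.
by rewrite lerDr sqr_ge0.
Qed.

Lemma normY_le_add (x : V * Q) : normY x <= `|x.1| + `|x.2|.
Proof.
rewrite -[leRHS]ger0_norm ?addr_ge0// -sqrtr_sqr ler_sqrt ?sqr_ge0//.
have : 0 <= `|x.1| * `|x.2| by rewrite mulr_ge0.
lra.
Qed.

Lemma normY_gt0 (x : V * Q) : x != 0 -> 0 < normY x.
Proof.
case: x => u p x0; rewrite sqrtr_gt0 /=.
have [u0|u0] := eqVneq u 0; last first.
  by rewrite ltr_pwDl ?exprn_gt0 ?normr_gt0 ?sqr_ge0.
rewrite ltr_pwDr ?sqr_ge0// exprn_gt0// normr_gt0.
by apply: contraNneq x0 => p0; rewrite u0 p0.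
Qed.

(** * Continuity and inf-sup stability of [calA] *)

Lemma calA_le (C : R) : 0 <= C ->
  (forall u v, a u v <= C * `|u| * `|v|) ->
  forall x y : V * Q, calA a b c x y <= (C + 3) * normY x * normY y.
Proof.
move=> C0 aC x y.
have nx : 0 <= normY x by rewrite sqrtr_ge0.
have n1 := norm1_le_normY; have n2 := norm2_le_normY.
have h1 : `|x.1| * `|y.1| <= normY x * normY y by rewrite ler_pM.
have h2 : `|y.1| * `|x.2| <= normY x * normY y by rewrite mulrC ler_pM.
have h3 : `|x.1| * `|y.2| <= normY x * normY y by rewrite ler_pM.
have h4 : `|x.2| * `|y.2| <= normY x * normY y by rewrite ler_pM.
have := norm_b_le y.1 x.2; have := norm_b_le x.1 y.2; have := norm_c_le x.2 y.2.
rewrite !ler_norml => /andP[c1 _] /andP[_ b1] /andP[_ b2].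
have := aC x.1 y.1; rewrite /calA -mulrA.
have : C * (`|x.1| * `|y.1|) <= C * (normY x * normY y) by rewrite ler_wpM2l.
lra.
Qed.

Lemma calA_test (C ca beta : R) : 0 <= C ->
  (forall v, a v v <= C * `|v| ^+ 2) ->
  0 < ca -> (forall v : V, ca * NV v ^+ 2 <= a v v) ->
  0 < beta ->
  (forall q : Q, beta * form_seminorm d q <=
     sup [set b v q / `|v| | v in [set v : V | v != 0]]) ->
  exists m K, [/\ 0 < m, 0 < K & forall x, exists y : V * Q,
    m * normY x ^+ 2 <= calA a b c x y /\ normY y <= K * normY x].
Proof.
move=> C0 aC ca0 caNV beta0 bsup.
(* In [k], the part [C / beta] pays for [a u v]. After absorption [ca] is left on [NV u ^+ 2],
   [1 / 2] on [|pu| ^+ 2], at least [1 / 2] on [c p p], and [beta / 4] on [s ^+ 2]. *)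
pose k := 1 + C / beta; pose m := Num.min ca (Num.min (1 / 2) (beta / 4)).
have k1 : 0 <= C / beta by rewrite divr_ge0// ltW.
have m0 : 0 < m by rewrite !lt_min ca0 divr_gt0// divr_gt0.
have mca : m <= ca by rewrite ge_min lexx.
have m2 : m <= 1 / 2 by rewrite !ge_min lexx orbT.
have mb : m <= beta / 4 by rewrite !ge_min lexx !orbT.
(* Since [|v| <= |p|] and [|pu| <= |u|], the test pair is bounded by [(k + 1) * (|u| + |p|)]. *)
exists m, (2 * (k + 1)); split => //; first by rewrite /k; lra.
case=> u p.
have [pu puE bu] := opB_riesz u.
pose s := form_seminorm d p.
have s0 : 0 <= s by exact: sqrtr_ge0.
have sp : s <= `|p| by exact: form_seminorm_le_norm.
have [v vs bv] : exists2 v : V, `|v| <= s & beta * s / 2 * s <= b v p.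
  apply: (sup_quotient_witness (l := applyr b p)) => //; last exact: bsup.
  by rewrite mulr_ge0// ltW.
exists (k *: u + v, - k *: p + pu); split.
  (* The share [beta / 4] is half of what [b v p] contributes. *)
  have auv : `|a u v| <= C / beta * a u u + beta / 4 * s ^+ 2.
    apply: norm_le_amgm; first by rewrite mulr_ge0 ?a_psd.
      by rewrite mulr_ge0 ?sqr_ge0// divr_ge0// ltW.
    apply: le_trans (psd_cauchy_schwarz a_psd u v) _.
    have -> : 4 * (C / beta * a u u) * (beta / 4 * s ^+ 2) =
        a u u * (C * s ^+ 2).
      by field; rewrite gt_eqF.
    rewrite ler_wpM2l ?a_psd//; apply: le_trans (aC v) _.
    by rewrite ler_wpM2l// ler_pXn2r ?nnegrE.
  have cpu : `|c p pu| <= c p p / 2 + `|pu| ^+ 2 / 2.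
    apply: norm_le_amgm; rewrite ?divr_ge0 ?c_psd ?sqr_ge0//.
    apply: le_trans (psd_cauchy_schwarz c_psd p pu) _.
    have := ler_wpM2l (c_psd p) (c_le_sqr_norm pu); lra.
  have bupu : b u pu = `|pu| ^+ 2.
    by rewrite puE /opQbar fittedQ_sqr_norm addrC.
  have pn : `|p| ^+ 2 = s ^+ 2 + c p p by case: fitQ => _ ->.
  have un : `|u| ^+ 2 = NV u ^+ 2 + `|pu| ^+ 2.
    by case: fitV => _ _ _ ->; rewrite bu.
  rewrite /normY sqr_sqrtr ?addr_ge0 ?sqr_ge0//= pn un /calA /=.
  have -> : a u (k *: u + v) = k * a u u + a u v.
    by rewrite linearDr /= linearZr_LR.
  have -> : b (k *: u + v) p = k * b u p + b v p.
    by rewrite linearDl /= linearZl_LR.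
  have -> : b u (- k *: p + pu) = - k * b u p + b u pu.
    by rewrite linearDr /= linearZr_LR.
  have -> : c p (- k *: p + pu) = - k * c p p + c p pu.
    by rewrite linearDr /= linearZr_LR.
  move: auv cpu; rewrite !ler_norml => /andP[auv _] /andP[_ cpu].
  have h1 : m * NV u ^+ 2 <= ca * NV u ^+ 2 by rewrite ler_wpM2r ?sqr_ge0.
  have h2 : m * `|pu| ^+ 2 <= 1 / 2 * `|pu| ^+ 2 by rewrite ler_wpM2r ?sqr_ge0.
  have h3 : m * s ^+ 2 <= beta / 4 * s ^+ 2 by rewrite ler_wpM2r ?sqr_ge0.
  have h4 : m * c p p <= 1 / 2 * c p p by rewrite ler_wpM2r ?c_psd.
  have h5 : 0 <= C / beta * c p p by rewrite mulr_ge0 ?c_psd.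
  have := caNV u; have := c_psd p; rewrite bupu /k; lra.
have k0 : 0 <= k by rewrite /k; lra.
have y1 : `|k *: u + v| <= k * `|u| + `|p|.
  apply: le_trans (ler_normD _ _) _; rewrite normrZ ger0_norm// lerD2l.
  exact: le_trans sp.
have y2 : `|- k *: p + pu| <= k * `|p| + `|u|.
  apply: le_trans (ler_normD _ _) _.
  by rewrite normrZ normrN ger0_norm// lerD2l -bu seminorm_b_le_norm.
apply: le_trans (normY_le_add _) _ => /=.
have := norm1_le_normY (u, p); have := norm2_le_normY (u, p) => /= n2 n1.
have := ler_wpM2l k0 n1; have := ler_wpM2l k0 n2; lra.
Qed.

(** The test [y] is nonzero because [calA] vanishes at [y = 0]. Continuity bounds the quotients, so
    their real supremum dominates the one at [y]. *)
Lemma infsup_calA_ge (C m K : R) : 0 <= C -> 0 < m -> 0 < K ->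
  (forall x y : V * Q, calA a b c x y <= C * normY x * normY y) ->
  (forall x, exists y : V * Q,
    m * normY x ^+ 2 <= calA a b c x y /\ normY y <= K * normY x) ->
  ((m / K)%:E <= infsup_calA a b c)%E.
Proof.
move=> C0 m0 K0 AC test; apply/ereal_infP => _ [x /= x0 <-].
rewrite lee_fin; have nx := normY_gt0 x0; have [y [Ay yK]] := test x.
have y0 : y != 0.
  apply: contraTneq Ay => ->; rewrite -ltNge /calA /= !linear0r linear0l.
  by rewrite !addr0 subr0 mulr_gt0// exprn_gt0.
have ny := normY_gt0 y0.
apply: (@le_trans _ _ (calA a b c x y / (normY x * normY y))).
  rewrite ler_pdivlMr ?mulr_gt0//; apply: le_trans Ay.
  have -> : m / K * (normY x * normY y) = m * normY x * (normY y / K) by ring.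
  rewrite (_ : m * _ ^+ 2 = m * normY x * normY x); last by ring.
  apply: ler_wpM2l; first by rewrite mulr_ge0// ltW.
  by rewrite ler_pdivrMr// mulrC.
apply: ub_le_sup; last by exists y.
exists C => _ [z /= z0 <-]; have nz := normY_gt0 z0.
by rewrite ler_pdivrMr ?mulr_gt0// mulrA.
Qed.

End FittedNorms.

Unset Implicit Arguments.

Theorem theorem2p14 (R : realType) (V Q : completeNormedModType R)
    (ipV : {dot V for idfun}) (ipQ : {dot Q for idfun})
    (hilbertV : norm_induced_by ipV) (hilbertQ : norm_induced_by ipQ)
    (a : {symmetric V}) (c : {symmetric Q})
    (b : {bilinear V -> Q -> R | *%R & *%R})
    (a_psd : possemidef a) (c_psd : possemidef c)
    (b_bounded : bounded_form b) (c_bounded : bounded_form c)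
    (d : {symmetric Q}) (NV : V -> R)
    (fitQ : fittedQ c d) (fitV : fittedV a b c d NV) :
  [/\ forall (v : V) (q : Q), b v q <= `|v| * `|q|,
      forall p q : Q, c p q <= `|p| * `|q|
    & forall Ca ca beta : R,
        (forall u v : V, a u v <= Ca * `|u| * `|v|) ->
        0 < ca -> (forall v : V, ca * NV v ^+ 2 <= a v v) ->
        0 < beta ->
        (forall q : Q,
           beta * form_seminorm d q <=
             sup [set b v q / `|v| | v in [set v : V | v != 0]]) ->
        exists C alpha : R,
          [/\ 0 < C, 0 < alpha,
              forall x y : V * Q, calA a b c x y <= C * normY x * normY y
            & (alpha%:E <= infsup_calA a b c)%E]].
Proof.
have ipE := sqr_norm_induced hilbertQ.
split=> [v q|p q|Ca ca beta aCa ca0 caNV beta0 bsup].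
- apply: le_trans (ler_norm _) _.
  exact: (norm_b_le (ipQ := ipQ) ipE b_bounded fitQ fitV v q).
- exact: le_trans (ler_norm _) (norm_c_le c_psd fitQ p q).
(* [Ca] can be negative when [V] is trivial. *)
pose C := Num.max Ca 0; have C0 : 0 <= C by rewrite le_max lexx orbT.
have aC u v : a u v <= C * `|u| * `|v|.
  by apply: le_trans (aCa u v) _; rewrite !ler_wpM2r// le_max lexx.
have aC2 v : a v v <= C * `|v| ^+ 2 by rewrite expr2 mulrA.
have AC := calA_le (ipQ := ipQ) ipE c_psd b_bounded fitQ fitV C0 aC.
have [m [K [m0 K0 test]]] :=
  calA_test (ipQ := ipQ) ipE a_psd c_psd b_bounded fitQ fitV
    C0 aC2 ca0 caNV beta0 bsup.
have C3 : 0 < C + 3 by rewrite ltr_wpDl.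
exists (C + 3), (m / K); split => //; first exact: divr_gt0.
exact: infsup_calA_ge (ltW C3) m0 K0 AC test.
Qed.
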